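(* (i) For every $k\ge5$, the classes $\mathfrak{L}(\mathbf{H})^w_{O(n)}$ and $\mathfrak{L}(\mathbb{Z}^k)^w_{O(n)}$ are incomparable (neither contains the other). (ii) The classes $\mathfrak{L}(\mathbf{H})^w_{O(n)}$ and $\mathsf{CF}$ are incomparable.
   Context: For a group $G$ with identity $e$, a $G$-automaton is a tuple $(Q,\Sigma,G,\delta,q_0,Q_a)$ where $Q$ is a finite set of states, $\Sigma$ a finite input alphabet, $q_0\in Q$ the initial state, $Q_a\subseteq Q$ the accepting states, and $\delta$ assigns to each $(q,\sigma)\in Q\times(\Sigma\cup\{\varepsilon\})$ a finite set of pairs $(q',m)\in Q\times G$. The register holds an element of $G$, initially $e$; using a transition $(q',m)\in\delta(q,\sigma)$ (one step) the automaton reads $\sigma$ (or nothing), moves to $q'$ and replaces the register content $x$ by $xm$. A word is accepted if some computation reads it entirely and ends in an accepting state with register equal to $e$. A $G$-automaton recognizing $\mathtt{L}$ is weakly $t(n)$ time-bounded if every $x\in\mathtt{L}$ with $|x|=n$ has an accepting computation of at most $t(n)$ steps; $\mathfrak{L}(G)^w_{O(n)}$ is the class of languages recognized by weakly $t(n)$ time-bounded $G$-automata for some $t(n)=O(n)$. $\mathbf{H}$ is the discrete Heisenberg group of $3\times3$ upper unitriangular integer matrices; $\mathbb{Z}^k$ is the free Abelian group of rank $k$; $\mathsf{CF}$ is the class of context-free languages. *)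

(* Defs.v *)
From HB Require Import structures.
From mathcomp Require Import all_boot all_order all_algebra.
Set Implicit Arguments. Unset Strict Implicit. Unset Printing Implicit Defensive.
Import Order.TTheory GRing.Theory Num.Theory.
Local Open Scope ring_scope.

(* ---------- G-automata ----------
   A group G is presented as a subset [inG] of a carrier type [T] equipped
   with a multiplication [mul] and identity [e]. *)

Record gautomaton (T : eqType) (Sigma : finType) := GAut {
  gQ : finType;
  gdelta : gQ -> option Sigma -> seq (gQ * T); (* finite set of (q', m) *)
  gq0 : gQ;
  gacc : {set gQ}
}.

Inductive gsteps (T : eqType) (Sigma : finType) (mul : T -> T -> T)
    (A : gautomaton T Sigma) : gQ A -> T -> seq Sigma -> nat -> gQ A -> T -> Prop :=
| gsteps_nil q x : @gsteps T Sigma mul A q x [::] 0 q x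
| gsteps_eps q x w n q1 m q2 y :
    (q1, m) \in gdelta q None -> @gsteps T Sigma mul A q1 (mul x m) w n q2 y ->
    @gsteps T Sigma mul A q x w n.+1 q2 y
| gsteps_read q x a w n q1 m q2 y :
    (q1, m) \in gdelta q (Some a) -> @gsteps T Sigma mul A q1 (mul x m) w n q2 y ->
    @gsteps T Sigma mul A q x (a :: w) n.+1 q2 y.

Definition gaccepts_within (T : eqType) (Sigma : finType) (mul : T -> T -> T)
    (e : T) (A : gautomaton T Sigma) (w : seq Sigma) (t : nat) : Prop :=
  exists n q, (n <= t)%N /\ q \in gacc A /\ @gsteps T Sigma mul A (gq0 A) e w n q e.

Definition gaccepts (T : eqType) (Sigma : finType) (mul : T -> T -> T)
    (e : T) (A : gautomaton T Sigma) (w : seq Sigma) : Prop :=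
  exists n q, q \in gacc A /\ @gsteps T Sigma mul A (gq0 A) e w n q e.

Definition is_G_automaton (T : eqType) (Sigma : finType) (inG : pred T)
    (A : gautomaton T Sigma) : Prop :=
  forall q s p, p \in @gdelta T Sigma A q s -> inG p.2.

Definition weakly_linear_G_language (T : eqType) (mul : T -> T -> T) (e : T)
    (inG : pred T) (Sigma : finType) (L : seq Sigma -> Prop) : Prop :=
  exists (A : gautomaton T Sigma),
    is_G_automaton inG A /\
    (forall w, L w <-> gaccepts mul e A w) /\
    exists t : nat -> nat,
      (exists c N : nat, forall n, (N <= n)%N -> (t n <= c * n)%N) /\
      (forall w, L w -> gaccepts_within mul e A w (t (size w))).

Definition heisenberg_mem : pred 'M[int]_3 :=
  fun M => [forall i : 'I_3, forall j : 'I_3,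
    ((j < i)%N ==> (M i j == 0)) && ((i == j) ==> (M i j == 1))].

Definition L_H_lin (Sigma : finType) (L : seq Sigma -> Prop) : Prop :=
  weakly_linear_G_language (@mulmx int 3 3 3) (1%:M) heisenberg_mem L.

Definition L_Zk_lin (k : nat) (Sigma : finType) (L : seq Sigma -> Prop) : Prop :=
  weakly_linear_G_language (@GRing.add 'rV[int]_k) 0 predT L.

Record cfg (Sigma : finType) := CFG {
  cfgN : finType;
  cfgS : cfgN;
  cfgP : seq (cfgN * seq (cfgN + Sigma))
}.

Definition cfg_step (Sigma : finType) (G : cfg Sigma)
    (u v : seq (cfgN G + Sigma)) : Prop :=
  exists l r X rhs, (X, rhs) \in cfgP G /\
    u = l ++ inl X :: r /\ v = l ++ rhs ++ r.

Inductive cfg_derives (Sigma : finType) (G : cfg Sigma) :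
    seq (cfgN G + Sigma) -> seq (cfgN G + Sigma) -> Prop :=
| cfg_refl u : @cfg_derives Sigma G u u
| cfg_trans u v x : @cfg_step Sigma G u v -> @cfg_derives Sigma G v x -> @cfg_derives Sigma G u x.

Definition context_free (Sigma : finType) (L : seq Sigma -> Prop) : Prop :=
  exists G : cfg Sigma, forall w,
    L w <-> @cfg_derives Sigma G [:: inl (cfgS G)] (map inr w).

Definition incomparable (C1 C2 : forall Sigma : finType, (seq Sigma -> Prop) -> Prop) : Prop :=
  (exists (Sigma : finType) (L : seq Sigma -> Prop), C1 Sigma L /\ ~ C2 Sigma L) /\
  (exists (Sigma : finType) (L : seq Sigma -> Prop), C2 Sigma L /\ ~ C1 Sigma L).

(* Main.v *)
Require Import Defs.
From mathcomp Require Import all_boot all_order all_algebra.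
From mathcomp Require Import zify ring.
From Stdlib Require Import ClassicalEpsilon.

(** Two obstructions are played against each other.

    Pumping: if a language with unbounded word lengths is context-free, or is
    recognized by a [Z^k]-automaton (with any time bound), then its set of
    lengths contains an infinite arithmetic progression.  For [Z^k] one takes
    infinitely many accepting runs; by Higman's lemma one of them, as a sequence
    of transitions, is a subsequence of a longer one, hence the longer one only
    inserts cycles, of total weight 0 by commutativity, which can be repeated.
    The unary language of triangular numbers therefore lies in neither class,
    but it is recognized in linear time over the Heisenberg group, as
    [heis 1 0 1 ^ p] has corner entry ['C(p, 2)].

    Counting: within [O(n)] steps an automaton over the Heisenberg group reaches
    only [O(n^4)] configurations.  There are at least [n^5] prefixes of length
    [O(n)] to be distinguished for the language of words over five pairs of
    letters with both letters of each pair equally frequent (recognized over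
    [Z^5]), and for the even palindromes. *)

Set Implicit Arguments. Unset Strict Implicit. Unset Printing Implicit Defensive.
Import GRing.Theory Num.Theory.
Local Open Scope ring_scope.

(** * Pumping the lengths of a context-free language *)

Definition lengths_contain_progression (T : Type) (L : seq T -> Prop) : Prop :=
  exists n0 d, (0 < d)%N /\
    forall i, exists2 w, L w & size w = (n0 + i * d)%N.

Section ContextFreePumping.
Variables (Sigma : finType) (G : cfg Sigma).
Local Notation form := (seq (cfgN G + Sigma)).
Local Notation derives := (@cfg_derives Sigma G).
Local Notation word w := (map inr w : form).

Lemma derives_trans (u v w : form) : derives u v -> derives v w -> derives u w.
Proof. by elim=> // u1 v1 x st _ IH /IH; apply: cfg_trans. Qed.

Lemma derives_context (l r u v : form) :
  derives u v -> derives (l ++ u ++ r) (l ++ v ++ r).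
Proof.
elim=> [u0|u1 v1 x [l' [r' [X [rhs [Xr [-> ->]]]]]] _ IH]; first exact: cfg_refl.
apply: cfg_trans IH; exists (l ++ l'), (r' ++ r), X, rhs; split=> //.
by rewrite -!catA.
Qed.

Lemma derives_cat (s1 s2 t1 t2 : form) :
  derives s1 t1 -> derives s2 t2 -> derives (s1 ++ s2) (t1 ++ t2).
Proof.
move=> d1 d2; apply: (@derives_trans _ (t1 ++ s2)).
  exact: (derives_context [::] s2 d1).
by have := derives_context t1 [::] d2; rewrite !cats0.
Qed.

Lemma derives_rule X rhs (t : form) :
  (X, rhs) \in cfgP G -> derives rhs t -> derives [:: inl X] t.
Proof.
by move=> Xr; apply: cfg_trans; exists [::], [::], X, rhs; rewrite /= cats0.
Qed.

(** Parse forests with their frontier: the big-step form of a derivation, on which structural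
    induction is possible. *)
Inductive yields : form -> seq Sigma -> Prop :=
| yields_nil : yields [::] [::]
| yields_letter a s w : yields s w -> yields (inr a :: s) (a :: w)
| yields_rule X rhs s w1 w2 : (X, rhs) \in cfgP G ->
    yields rhs w1 -> yields s w2 -> yields (inl X :: s) (w1 ++ w2).

Lemma yields_catI (s1 s2 : form) w : yields (s1 ++ s2) w ->
  exists w1 w2, [/\ w = w1 ++ w2, yields s1 w1 & yields s2 w2].
Proof.
elim: s1 w => [|x s1 IH] w /=; first by exists [::], w; split=> //; constructor.
case Ds: _ w / => [|a s w yw|X rhs s w1 w2 Xr y1 y2] //.
  case: Ds yw => -> <- /IH[w1 [w2 [-> y1 y2]]].
  by exists (a :: w1), w2; split=> //; constructor.
case: Ds y2 => -> <- /IH[w3 [w4 [-> y3 y4]]].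
by exists (w1 ++ w3), w4; rewrite catA; split=> //; apply: yields_rule Xr y1 y3.
Qed.

Lemma yields_cat (s1 s2 : form) w1 w2 :
  yields s1 w1 -> yields s2 w2 -> yields (s1 ++ s2) (w1 ++ w2).
Proof.
move=> y1 y2; elim: y1 => //= [a s w _ IH|X rhs s w3 w4 Xr y3 _ _ IH].
  by constructor.
by rewrite -catA; apply: yields_rule Xr y3 IH.
Qed.

Lemma derives_yields (s : form) w : derives s (word w) -> yields s w.
Proof.
move Dt: (word w) => t d; elim: d Dt => {s t} [s <-|].
  by elim: w => [|a w IH]; constructor.
move=> u v x [l [r [X [rhs [Xr [-> ->]]]]]] _ IH /IH.
case/yields_catI=> w1 [w' [-> y1]] /yields_catI[w2 [w3 [-> y2 y3]]].
by apply: yields_cat => //; apply: yields_rule Xr y2 y3.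
Qed.

(* Parse forests in which no nonterminal of [A] occurs and no nonterminal is
   repeated along a branch. *)
Inductive syields : {set cfgN G} -> form -> seq Sigma -> Prop :=
| syields_nil A : syields A [::] [::]
| syields_letter A a s w : syields A s w -> syields A (inr a :: s) (a :: w)
| syields_rule (A : {set cfgN G}) X rhs s w1 w2 : X \notin A -> (X, rhs) \in cfgP G ->
    syields (X |: A) rhs w1 -> syields A s w2 -> syields A (inl X :: s) (w1 ++ w2).

Lemma syields_derives A s w : syields A s w -> derives s (word w).
Proof.
elim=> {A s w} [A|A a s w _ IH|A X rhs s w1 w2 _ Xr _ d1 _ d2] /=.
- exact: cfg_refl.
- by apply: (@derives_cat [:: inr a] s [:: inr a]) => //; apply: cfg_refl.
rewrite map_cat; apply: (@derives_cat [:: inl X]) => //.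
exact: derives_rule Xr d1.
Qed.

Lemma syieldsS (A B : {set cfgN G}) s w : B \subset A -> syields A s w -> syields B s w.
Proof.
move=> sBA y; elim: y B sBA => {A s w} [A|A a s w _ IH|A X rhs s w1 w2 XA Xr _ IH1 _ IH2] B sBA.
- by constructor.
- by constructor; apply: IH.
apply: syields_rule Xr _ _; [|exact: IH1 (setUS _ sBA)|exact: IH2].
by apply: contra XA; apply: (subsetP sBA).
Qed.

Lemma syields_cat A s1 s2 w1 w2 :
  syields A s1 w1 -> syields A s2 w2 -> syields A (s1 ++ s2) (w1 ++ w2).
Proof.
move=> y; elim: y s2 w2 => {A s1 w1} //= [A a s w _ IH|A X rhs s w3 w4 XA Xr y3 _ _ IH] s2 w2 y2.
  by constructor; apply: IH.
by rewrite -catA; apply: syields_rule Xr y3 (IH _ _ y2).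
Qed.

(** Either [X] labels no node, so that it may join the forbidden set, or the subtree at a node
    labelled [X] can be cut out, leaving the context [u], [v] around it. *)
Lemma syields_avoid_or_occurs X A s w : syields A s w ->
  syields (X |: A) s w \/
  exists u v w', [/\ w = u ++ w' ++ v,
    derives s (word u ++ inl X :: word v) & syields set0 [:: inl X] w'].
Proof.
elim=> {A s w} [A|A a s w _ IH|A Y rhs s w1 w2 YA Yr y1 IH1 y2 IH2].
- by left; constructor.
- case: IH => [y|[u [v [w' [-> d y]]]]]; first by left; constructor.
  right; exists (a :: u), v, w'; split=> //=.
  by apply: (@derives_cat [:: inr a] s [:: inr a]) => //; apply: cfg_refl.
case: IH2 => [y2'|[u [v [w' [-> d y]]]]]; last first.
  right; exists (w1 ++ u), v, w'; rewrite map_cat -!catA; split=> //.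
  apply: (@derives_cat [:: inl Y]) => //.
  exact: derives_rule Yr (syields_derives y1).
case: (eqVneq Y X) => [<-|neqYX].
  right; exists [::], w2, w1; split=> //.
    apply: (@derives_cat [:: inl Y] s [:: inl Y]); first exact: cfg_refl.
    exact: syields_derives y2.
  rewrite -[w1]cats0; apply: syields_rule Yr _ _; rewrite ?inE //; last by constructor.
  by apply: syieldsS y1; rewrite setU0 subsetUl.
case: IH1 => [y1'|[u [v [w' [-> d y]]]]].
  left; apply: syields_rule Yr _ y2'; first by rewrite !inE negb_or neqYX.
  by rewrite setUCA.
right; exists u, (v ++ w2), w'; rewrite -!catA map_cat; split=> //.
have := derives_cat (derives_rule Yr d) (syields_derives y2).
by rewrite -catA.
Qed.

Definition pumpable (s : form) :=
  lengths_contain_progression (fun w => derives s (word w)).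

Lemma pumpable_cat s1 s2 w : derives s1 (word w) -> pumpable s2 -> pumpable (s1 ++ s2).
Proof.
move=> d1 [n0 [d [d_gt0 H]]]; exists (size w + n0)%N, d; split=> // i.
have [w' d2 sz] := H i; exists (w ++ w'); last by rewrite size_cat sz addnA.
by rewrite map_cat; apply: derives_cat.
Qed.

Lemma pumpable_catr s1 s2 w : pumpable s1 -> derives s2 (word w) -> pumpable (s1 ++ s2).
Proof.
move=> [n0 [d [d_gt0 H]]] d2; exists (size w + n0)%N, d; split=> // i.
have [w' d1 sz] := H i; exists (w' ++ w); last by rewrite size_cat sz addnC addnA.
by rewrite map_cat; apply: derives_cat.
Qed.

Lemma pumpable_loop X u v w :
  derives [:: inl X] (word u ++ inl X :: word v) -> derives [:: inl X] (word w) ->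
  (0 < size (u ++ v))%N -> pumpable [:: inl X].
Proof.
move=> loop dw gt0; exists (size w), (size (u ++ v)); split=> //.
elim=> [|i [w' d' sz]]; first by exists w; rewrite ?addn0.
exists (u ++ w' ++ v); last by rewrite mulSn !size_cat sz size_cat; lia.
apply: derives_trans loop _; rewrite !map_cat.
apply: derives_cat; first exact: cfg_refl.
by apply: (@derives_cat [:: inl X]) => //; apply: cfg_refl.
Qed.

(** Trees are simplified from the leaves upwards. If the root [X] recurs below itself, then [X]
    derives [u X v]: a nonempty [u ++ v] can be pumped. *)
Lemma yields_syields_or_pumpable s w : yields s w -> syields set0 s w \/ pumpable s.
Proof.
elim=> {s w} [|a s w y [IH|IH]|X rhs s w1 w2 Xr y1 IH1 y2 IH2].
- by left; constructor.
- by left; constructor.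
- by right; apply: (@pumpable_cat [:: inr a] s [:: a]) => //; apply: cfg_refl.
have dX := derives_rule Xr.
case: IH1 IH2 => [IH1|[n0 [d [d_gt0 H]]]] IH2; last first.
  right; have [w2' d2] : exists w2', derives s (word w2').
    case: IH2 => [/syields_derives|[n0' [d' [_ H']]]]; first by exists w2.
    by have [w2' d2 _] := H' 0%N; exists w2'.
  apply: (@pumpable_catr [:: inl X] s) d2; exists n0, d; split=> // i.
  by have [w' d1 sz] := H i; exists w' => //; apply: dX.
case: IH2 => [IH2|IH2]; last first.
  by right; apply: (@pumpable_cat [:: inl X]) IH2; apply: dX (syields_derives IH1).
have [IH1'|[u [v [w' [Dw d y]]]]] := syields_avoid_or_occurs X IH1.
  by left; apply: syields_rule Xr IH1' IH2; rewrite inE.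
have [uv_gt0|] := ltnP 0 (size (u ++ v)).
  right; apply: (@pumpable_catr [:: inl X] s) (syields_derives IH2).
  exact: pumpable_loop (dX _ d) (syields_derives y) uv_gt0.
(* The loop adds no letter, so the inner tree rooted at [X] yields the same word and replaces the
   outer one. *)
rewrite leqn0 size_cat addn_eq0 !size_eq0 => /andP[/eqP u0 /eqP v0].
left; move: Dw; rewrite u0 v0 cats0 /= => ->.
exact: (@syields_cat _ [:: inl X]).
Qed.

(** A branch carries at most [#|cfgN G| - #|A|] distinct nonterminals, and each of them has at most
    [R] children. *)
Lemma syields_size (R : nat) A s w :
  (0 < R)%N -> (forall X rhs, (X, rhs) \in cfgP G -> (size rhs <= R)%N) ->
  syields A s w -> (size w <= size s * R ^ (#|cfgN G| - #|A|))%N.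
Proof.
move=> R_gt0 HR; elim=> {A s w} [A|A a s w _ IH|A X rhs s w1 w2 XA Xr _ IH1 _ IH2] //=.
  by rewrite mulSn -add1n leq_add // expn_gt0 R_gt0.
rewrite size_cat mulSn leq_add //; apply: leq_trans IH1 _.
have := max_card (mem (X |: A)); rewrite cardsU1 XA => ltA.
rewrite (_ : (#|cfgN G| - #|A| = (#|cfgN G| - (true + #|A|)).+1)%N); last by lia.
by rewrite expnS leq_mul2r (HR _ _ Xr) orbT.
Qed.

End ContextFreePumping.

Lemma context_free_lengths (Sigma : finType) (L : seq Sigma -> Prop) :
  context_free L -> (forall n, exists2 w, L w & (n <= size w)%N) ->
  lengths_contain_progression L.
Proof.
move=> [G GL] unb.
(* The successor keeps [R] positive even if all right-hand sides are empty. *)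
pose R := (\max_(p <- cfgP G) size p.2).+1.
have HR X rhs : (X, rhs) \in cfgP G -> (size rhs <= R)%N.
  move=> Xr; apply: leqW.
  exact: (@leq_bigmax_seq _ _ _ (fun p : cfgN G * seq (cfgN G + Sigma) => size p.2) _ Xr).
have [w Lw] := unb (R ^ #|cfgN G|).+1.
have /derives_yields/yields_syields_or_pumpable[y|] := (GL w).1 Lw.
  have := syields_size (ltn0Sn _) HR y.
  by rewrite cards0 subn0 mul1n leqNgt => /negP.
move=> [n0 [d [d_gt0 H]]] _; exists n0, d; split=> // i.
by have [w' /GL Lw' sz] := H i; exists w'.
Qed.

(** * Higman's lemma over a finite alphabet *)

Section Higman.
Variable T : eqType.

(** Infinite pigeonhole: were each letter of [s] to occur only finitely often, no value would be
    left for large indices. [phi] then jumps from one occurrence of [c] to the next. *)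
Lemma constant_subsequence (s : seq T) (a : nat -> T) :
  (forall n, a n \in s) ->
  exists c (phi : nat -> nat),
    {homo phi : i j / (i < j)%N} /\ forall k, a (phi k) = c.
Proof.
move=> as_.
have [c Hc] : exists c, forall N, exists n, (N <= n)%N && (a n == c).
  apply: NNPP => nex.
  have [N HN] : exists N, forall n, (N <= n)%N -> a n \notin s.
    elim: s {as_} => [|c s [N HN]]; first by exists 0%N.
    have [M HM] : exists M, forall n, (M <= n)%N -> a n != c.
      apply: NNPP => nM; apply: nex; exists c => M; apply: NNPP => nn; apply: nM.
      exists M => n le; apply/negP => e; apply: nn; exists n; exact/andP.
    exists (maxn N M) => n; rewrite geq_max inE negb_or => /andP[leN leM].
    by rewrite HM ?HN.
  by have := HN N (leqnn N); rewrite as_.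
pose g N := xchoose (Hc N).
have gP N : (N <= g N)%N && (a (g N) == c) := xchooseP (Hc N).
pose fix phi k := if k is k'.+1 then g (phi k').+1 else g 0%N.
exists c, phi; split.
  by apply: homo_ltn => [? ? ?|k /=]; [apply: ltn_trans | case/andP: (gP (phi k).+1)].
by case=> [|k]; apply/eqP; [have := gP 0%N | have := gP (phi k).+1]; case/andP.
Qed.

Definition bad (s : seq T) (f : nat -> seq T) : Prop :=
  (forall n, {subset f n <= s}) /\
  forall i j, (i < j)%N -> ~~ subseq (f i) (f j).

Lemma exists_minimal (X : Type) (P : X -> Prop) (mu : X -> nat) (x : X) :
  P x -> exists y, P y /\ forall z, P z -> (mu y <= mu z)%N.
Proof.
elim/ltn_ind: {x}(mu x) {-2}x (erefl (mu x)) => m IH x Dm Px.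
case: (classic (exists2 z, P z & (mu z < m)%N)) => [[z Pz lt]|nex].
  exact: IH lt z erefl Pz.
exists x; split=> // z Pz; rewrite leqNgt; apply/negP => lt; apply: nex.
by exists z; rewrite -?Dm.
Qed.

(** Nash-Williams' minimal bad sequence: [G n] keeps the terms of its predecessor before index [n]
    and has the shortest possible term there; the diagonal is the limit. *)
Lemma minimal_bad_sequence (s : seq T) (f : nat -> seq T) : bad s f ->
  exists m, bad s m /\
    forall n h, bad s h -> (forall i, (i < n)%N -> h i = m i) ->
      (size (m n) <= size (h n))%N.
Proof.
move=> badf.
pose P n (g h : nat -> seq T) := bad s h /\ forall i, (i < n)%N -> h i = g i.
pose is_step n g h :=
  P n g h /\ forall h', P n g h' -> (size (h n) <= size (h' n))%N.
(* A total choice, whose specification is available when [g] is bad. *)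
pose step n g := epsilon (inhabits g) (is_step n g).
have stepP n g : bad s g -> is_step n g (step n g).
  move=> badg; apply: epsilon_spec.
  by apply: (@exists_minimal _ _ (fun h : nat -> seq T => size (h n)) g).
pose fix G n := if n is n'.+1 then step n (G n') else step 0%N f.
have badG n : bad s (G n).
  by elim: n => [|n IH] /=; [case: (stepP 0%N f badf) | case: (stepP n.+1 _ IH)]; case.
have GE n i : (i <= n)%N -> G n i = G i i.
  elim: n => [|n IH]; first by rewrite leqn0 => /eqP->.
  rewrite leq_eqVlt => /predU1P[->|lt] //.
  have [[_ E] _] := stepP n.+1 _ (badG n); rewrite -IH //; exact: E.
exists (fun n => G n n); split; first split=> [n|i j ltij].
- by case: (badG n).
- by rewrite -(GE _ _ (ltnW ltij)); apply: (badG j).2.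
case=> [|n] h badh E; first by apply: (stepP 0%N f badf).2; split.
apply: (stepP n.+1 _ (badG n)).2; split=> // i lti.
by rewrite E // GE.
Qed.

(** In a minimal bad sequence, infinitely many words share a head [c]. Replacing everything from the
    first of them on by the tails of these words gives a bad sequence with a shorter term. *)
Theorem higman (s : seq T) (f : nat -> seq T) :
  (forall n, {subset f n <= s}) -> exists i j, (i < j)%N /\ subseq (f i) (f j).
Proof.
move=> fs; apply: NNPP => nex.
have [m [[ms badm] minm]] : exists m, bad s m /\ forall n h, bad s h ->
    (forall i, (i < n)%N -> h i = m i) -> (size (m n) <= size (h n))%N.
  apply: (@minimal_bad_sequence s f); split=> // i j lt.
  by apply/negP => sub; apply: nex; exists i, j.
have m_cons n : exists x, m n = x :: behead (m n).
  by case E: (m n) (badm n n.+1 (ltnSn n)) => [|x v]; [rewrite sub0seq | exists x].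
have [x0 _] := m_cons 0%N.
pose a n := head x0 (m n); pose v n := behead (m n).
have mE n : m n = a n :: v n by rewrite /a /v; case: (m_cons n) => x ->.
have [n|c [phi [phi_lt aphi]]] := @constant_subsequence s a.
  by apply: (ms n); rewrite mE mem_head.
have phi_le : {homo phi : i j / (i <= j)%N}.
  by apply: ltnW_homo.
pose h i := if (i < phi 0)%N then m i else v (phi (i - phi 0))%N.
have vm n : subseq (v n) (m n) by rewrite mE subseq_cons.
have badh : bad s h.
  split=> [n x|i j ltij]; rewrite /h.
    case: ifP => _ xv; first exact: ms xv.
    by apply: ms (mem_subseq (vm _) xv).
  case: ltnP => [lti|lei]; case: ltnP => [ltj|lej].
  - exact: badm.
  - apply/negP => /subseq_trans/(_ (vm _)); apply/negP/badm.
    exact: leq_trans lti (phi_le _ _ _).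
  - by move: (leq_ltn_trans lei ltij); rewrite ltnNge (ltnW ltj).
  - have /badm : (phi (i - phi 0) < phi (j - phi 0))%N by apply: phi_lt; lia.
    by rewrite !mE !aphi /= eqxx.
have : (size (m (phi 0)) <= size (h (phi 0)))%N.
  by apply: minm badh _ => i lti; rewrite /h lti.
by rewrite /h ltnn subnn mE /= ltnn.
Qed.

End Higman.

(** * Pumping the lengths of an automaton over an abelian group *)

Lemma gsteps_cat (T : eqType) (Sigma : finType) (mul : T -> T -> T)
    (A : gautomaton T Sigma) q1 x1 w1 n1 q2 x2 w2 n2 q3 x3 :
  @gsteps T Sigma mul A q1 x1 w1 n1 q2 x2 -> @gsteps T Sigma mul A q2 x2 w2 n2 q3 x3 ->
  @gsteps T Sigma mul A q1 x1 (w1 ++ w2) (n1 + n2) q3 x3.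
Proof.
move=> s1 s2; elim: s1 s2 => {q1 x1 w1 n1 q2 x2} //= [q x w n q1 m q2 y tr _ IH
  |q x a w n q1 m q2 y tr _ IH] s2.
  exact: gsteps_eps tr (IH s2).
exact: gsteps_read tr (IH s2).
Qed.

Lemma gsteps_catI (T : eqType) (Sigma : finType) (mul : T -> T -> T)
    (A : gautomaton T Sigma) q1 x1 w1 w2 n q3 x3 :
  @gsteps T Sigma mul A q1 x1 (w1 ++ w2) n q3 x3 ->
  exists n1 n2 q2 x2, [/\ n = (n1 + n2)%N,
    @gsteps T Sigma mul A q1 x1 w1 n1 q2 x2 & @gsteps T Sigma mul A q2 x2 w2 n2 q3 x3].
Proof.
move Dw: (w1 ++ w2) => w s.
elim: s w1 Dw => {q1 x1 w n q3 x3} [q x|q x w n q1 m q2 y tr _ IH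
  |q x a w n q1 m q2 y tr s IH] w1 Dw.
- by case: w1 w2 Dw => // -[] //; exists 0%N, 0%N, q, x; split=> //; constructor.
- have [n1 [n2 [q' [x' [-> s1 s2]]]]] := IH _ Dw.
  by exists n1.+1, n2, q', x'; split=> //; apply: gsteps_eps tr s1.
case: w1 Dw => [|b w1] /= Dw.
  exists 0%N, n.+1, q, x; rewrite Dw; split=> //; first by constructor.
  exact: gsteps_read tr s.
case: Dw => -> /IH[n1 [n2 [q' [x' [-> s1 s2]]]]].
by exists n1.+1, n2, q', x'; split=> //; apply: gsteps_read tr s1.
Qed.

Section Transitions.
Variables (T : eqType) (Sigma : finType) (A : gautomaton T Sigma).

Definition transition : eqType := (gQ A * option Sigma * (gQ A * T))%type.

(** The register values need not form a finite type, so the finite alphabet of runs is given as a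
    list. *)
Definition transitions : seq transition :=
  [seq (p.1, p.2, t) | p <- enum {: gQ A * option Sigma}, t <- @gdelta T Sigma A p.1 p.2].

Lemma mem_transitions q l t : t \in @gdelta T Sigma A q l -> (q, l, t) \in transitions.
Proof. by move=> tr; apply/allpairsPdep; exists (q, l), t; rewrite mem_enum. Qed.

End Transitions.

Section AbelianPumping.
Variables (V : zmodType) (Sigma : finType) (A : gautomaton V Sigma).
Local Notation transition := (transition A).
Local Notation transitions := (transitions A).
Implicit Types (q : gQ A) (r : seq transition).

(** Runs without the register: the latter changes by the sum [weight r], which is invariant under
    permutation of [r]. *)
Fixpoint is_run q r q' : bool :=
  if r is e :: r' then
    [&& e.1.1 == q, e.2 \in @gdelta V Sigma A q e.1.2 & is_run e.2.1 r' q']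
  else q == q'.

Definition read_word r : seq Sigma := pmap (fun e : transition => e.1.2) r.
Definition weight r : V := \sum_(e <- r) e.2.2.

Lemma gsteps_is_run q x w n q' y :
  @gsteps V Sigma +%R A q x w n q' y ->
  exists r, [/\ is_run q r q', read_word r = w & x + weight r = y].
Proof.
elim=> {q x w n q' y} [q x|q x w n q1 m q2 y tr _ [r [run <- <-]]
  |q x a w n q1 m q2 y tr _ [r [run <- <-]]].
- by exists [::]; rewrite /weight big_nil addr0 /= eqxx.
- by exists ((q, None, (q1, m)) :: r); rewrite /weight big_cons addrA /= eqxx tr.
- by exists ((q, Some a, (q1, m)) :: r); rewrite /weight big_cons addrA /= eqxx tr.
Qed.

Lemma is_run_gsteps q x r q' : is_run q r q' ->
  @gsteps V Sigma +%R A q x (read_word r) (size r) q' (x + weight r).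
Proof.
elim: r q x => [|[[q1 l] [q2 m]] r IH] q x /=.
  by move=> /eqP->; rewrite /weight big_nil addr0; constructor.
case/and3P=> /eqP-> tr run; rewrite /weight big_cons addrA.
by case: l tr => [a|] tr; [apply: gsteps_read tr _ | apply: gsteps_eps tr _]; apply: IH.
Qed.

Lemma is_run_transitions q r q' : is_run q r q' -> {subset r <= transitions}.
Proof.
elim: r q => [|[[q1 l] t] r IH] q //= /and3P[/eqP-> tr run] e.
rewrite inE => /predU1P[->|]; last exact: IH run e.
exact: mem_transitions.
Qed.

Lemma is_run_cat q r1 r2 q' :
  is_run q (r1 ++ r2) q' <-> exists2 q1, is_run q r1 q1 & is_run q1 r2 q'.
Proof.
elim: r1 q => [|e r IH] q /=.
  by split=> [run|[q1 /eqP->]] //; exists q.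
split=> [/and3P[-> -> /IH[q1 run1 run2]]|[q1 /and3P[-> -> run1] run2]]; first by exists q1.
by apply/IH; exists q1.
Qed.

Lemma is_run_iter q r i : is_run q r q -> is_run q (flatten (nseq i r)) q.
Proof. by move=> run; elim: i => [|i IH] /=; [|apply/is_run_cat; exists q]. Qed.

Lemma subseq_cons_split (T : eqType) (x : T) (s1 s2 : seq T) :
  subseq (x :: s1) s2 -> exists s s3, s2 = s ++ x :: s3 /\ subseq s1 s3.
Proof.
elim: s2 => //= y s2 IH; case: eqP => [<- sub|_ /IH[s [s3 [-> sub]]]].
  by exists [::], s2.
by exists (y :: s), s3.
Qed.

Lemma count_flatten_nseq (T : eqType) (p : pred T) i (s : seq T) :
  count p (flatten (nseq i s)) = (i * count p s)%N.
Proof. by elim: i => //= i IH; rewrite count_cat IH mulSn. Qed.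

(* If [r1] is a subsequence of [r2], then [r2] arises from [r1] by inserting
   cycles, since consecutive transitions of [r1] share a state; these cycles
   can be repeated. *)
Lemma is_run_subseq_pump q r1 r2 q' i :
  is_run q r1 q' -> is_run q r2 q' -> subseq r1 r2 ->
  exists2 r, is_run q r q' &
    perm_eq (r ++ flatten (nseq i r1)) (r1 ++ flatten (nseq i r2)).
Proof.
move=> run1 run2 sub.
(* As multisets, [r] is [r1] plus [i] copies of [r2] minus [r1]; the equation avoids the
   subtraction. *)
suff [r run H] : exists2 r, is_run q r q' &
    forall p, (count p r + i * count p r1 = count p r1 + i * count p r2)%N.
  by exists r => //; apply/permP => p; rewrite !count_cat !count_flatten_nseq.
elim: r1 q r2 run1 run2 sub => [|e r1 IH] q r2 /=.
  move=> /eqP<- run2 _; exists (flatten (nseq i r2)); first exact: is_run_iter.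
  by move=> p; rewrite count_flatten_nseq muln0 addn0.
move=> /and3P[/eqP Dq tr run1] run2 /subseq_cons_split[s [r3 [Dr2 sub]]].
move: run2; rewrite {}Dr2 => /is_run_cat[q1 cyc] /= /and3P[/eqP Dq1 _ run3].
have [r run H] := IH _ _ run1 run3 sub.
exists (flatten (nseq i s) ++ e :: r).
  apply/is_run_cat; exists q; last by rewrite /= Dq eqxx tr.
  by apply: is_run_iter; rewrite -{2}Dq Dq1.
move=> p; have := H p; rewrite !count_cat /= count_flatten_nseq.
move: (nat_of_bool (p e)) (count p s) (count p r) (count p r1) (count p r3) => b c1 c2 c3 c4; nia.
Qed.

End AbelianPumping.

Lemma L_Zk_lin_lengths (k : nat) (Sigma : finType) (L : seq Sigma -> Prop) :
  L_Zk_lin k L -> (forall n, exists2 w, L w & (n <= size w)%N) ->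
  lengths_contain_progression L.
Proof.
move=> [A [_ [LA _]]] unb; pose q0 := gq0 A.
pose accepting n c := [/\ is_run q0 c.1 c.2, c.2 \in gacc A,
  weight c.1 = 0 & (n <= size (read_word c.1))%N].
have ex n : exists c, accepting n c.
  have [w Lw lew] := unb n; have [m [q [accq]]] := (LA w).1 Lw.
  by case/gsteps_is_run=> r [run Dw]; rewrite add0r => w0; exists (r, q); split; rewrite ?Dw.
have acceptL r q : is_run q0 r q -> q \in gacc A -> weight r = 0 -> L (read_word r).
  move=> run accq w0; apply/LA; exists (size r), q; split=> //.
  by have := is_run_gsteps 0 run; rewrite w0 addr0.
pose next n := sval (constructive_indefinite_description _ (ex n)).
have nextP n : accepting n (next n) := svalP (constructive_indefinite_description _ (ex n)).
(* Accepting runs on strictly longer and longer words. *)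
pose fix f n := if n is n'.+1 then next (size (read_word (f n').1)).+1 else next 0%N.
have fP n : accepting 0%N (f n) by case: n => [|n] /=;
  [case: (nextP 0%N) | case: (nextP (size (read_word (f n).1)).+1)]; split.
have f_lt : {homo (fun n => size (read_word (f n).1)) : i j / (i < j)%N}.
  apply: homo_ltn => [? ? ?|n /=]; first exact: ltn_trans.
  by case: (nextP (size (read_word (f n).1)).+1).
(* Pumping compares runs with the same endpoints, so the final state is made constant first. *)
have [n|qf [phi [phi_lt finE]]] := @constant_subsequence _ (enum (gQ A)) (fun n => (f n).2).
  exact: mem_enum.
have [n|i [j [ltij sub]]] := @higman _ (transitions A) (fun n => (f (phi n)).1).
  by case: (fP (phi n)) => /is_run_transitions.
case: (fP (phi i)) (fP (phi j)); rewrite !finE => run1 accq w1 _ []; rewrite !finE => run2 _ w2 _.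
have lt12 := f_lt _ _ (phi_lt _ _ ltij); rewrite /= in lt12.
exists (size (read_word (f (phi i)).1)), (size (read_word (f (phi j)).1) - size (read_word (f
  (phi i)).1))%N.
split=> [|l]; first by rewrite subn_gt0.
have [r run eqr] := is_run_subseq_pump l run1 run2 sub.
have weight_iter r' : weight r' = 0 -> weight (flatten (nseq l r')) = 0.
  by move=> r'0; elim: l {eqr} => [|l IH];
    rewrite /weight ?big_nil // big_cat /= -/(weight _) r'0 add0r.
have weight_cat r' r'' : weight (r' ++ r'') = weight r' + weight r'' by exact: big_cat.
exists (read_word r).
  apply: acceptL run accq _.
  have := perm_big _ eqr : weight _ = weight _.
  by rewrite !weight_cat !weight_iter // w1 !addr0.
pose p : pred (transition A) := fun e => e.1.2 : bool.
have sz r' : size (read_word r') = count p r' by rewrite size_pmap.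
have /permP/(_ p) := eqr; rewrite !count_cat !count_flatten_nseq !sz in lt12 *.
move: (count p _) (count p _) (count p _) lt12 => n1 n2 n3; nia.
Qed.

(** * Growth of the Heisenberg group *)

Definition heis (a b c : int) : 'M[int]_3 :=
  \matrix_(i, j) nth 0 (nth [::] [:: [:: 1; a; b]; [:: 0; 1; c]; [:: 0; 0; 1]] i) j.

Lemma heisM a b c a' b' c' :
  heis a b c *m heis a' b' c' = heis (a + a') (b + a * c' + b') (c + c').
Proof.
apply/matrixP=> i j; rewrite !mxE !big_ord_recl big_ord0 !mxE /=.
by case: i j => [[|[|[|//]]] ?] [[|[|[|//]]] ?] /=; ring.
Qed.

Lemma heis1 : 1%:M = heis 0 0 0.
Proof.
by apply/matrixP=> i j; rewrite !mxE; case: i j => [[|[|[|//]]] ?] [[|[|[|//]]] ?].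
Qed.

Lemma heis_inj a b c a' b' c' :
  heis a b c = heis a' b' c' -> [/\ a = a', b = b' & c = c'].
Proof.
pose o (k : nat) (lt : (k < 3)%N) := Ordinal lt.
move/matrixP=> E; split.
- by have := E (@o 0%N isT) (@o 1%N isT); rewrite !mxE.
- by have := E (@o 0%N isT) (@o 2%N isT); rewrite !mxE.
- by have := E (@o 1%N isT) (@o 2%N isT); rewrite !mxE.
Qed.

Lemma heisenberg_mem_heis a b c : heisenberg_mem (heis a b c).
Proof.
apply/forallP=> i; apply/forallP=> j; rewrite !mxE.
by case: i j => [[|[|[|//]]] ?] [[|[|[|//]]] ?].
Qed.

Lemma heis_entries_le K a b c : (forall i j, (`|heis a b c i j| <= K)%N) ->
  [/\ (`|a| <= K)%N, (`|b| <= K)%N & (`|c| <= K)%N].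
Proof.
pose o (k : nat) (lt : (k < 3)%N) := Ordinal lt.
move=> E; split.
- by have := E (@o 0%N isT) (@o 1%N isT); rewrite !mxE.
- by have := E (@o 0%N isT) (@o 2%N isT); rewrite !mxE.
- by have := E (@o 1%N isT) (@o 2%N isT); rewrite !mxE.
Qed.

Lemma heisenberg_memP M : heisenberg_mem M -> exists a b c, M = heis a b c.
Proof.
pose o (k : nat) (lt : (k < 3)%N) := Ordinal lt.
move=> HM; exists (M (@o 0%N isT) (@o 1%N isT)), (M (@o 0%N isT) (@o 2%N isT)),
  (M (@o 1%N isT) (@o 2%N isT)).
apply/matrixP=> i j; rewrite mxE.
have /forallP/(_ j)/andP[/implyP low /implyP diag] := forallP HM i.
case: i j low diag => [[|[|[|//]]] ?] [[|[|[|//]]] ?] /= low diag;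
  by [exact/eqP/low | exact/eqP/diag | congr (M _ _); apply: val_inj].
Qed.

(** The two entries next to the diagonal grow linearly, the corner quadratically: one step adds to
    it at most [K] plus a product bounded by [K * n * K]. *)
Definition in_ball (K n : nat) (x : 'M[int]_3) : Prop :=
  exists a b c, [/\ x = heis a b c, (`|a| <= K * n)%N,
    (`|b| <= (K + K ^ 2) * n ^ 2)%N & (`|c| <= K * n)%N].

Lemma in_ball_le K m n x : (m <= n)%N -> in_ball K m x -> in_ball K n x.
Proof.
move=> lemn [a [b [c [-> Ha Hb Hc]]]]; exists a, b, c; split=> //.
- by apply: leq_trans Ha _; rewrite leq_mul2l lemn orbT.
- by apply: leq_trans Hb _; rewrite leq_mul2l leq_exp2r ?lemn ?orbT.
- by apply: leq_trans Hc _; rewrite leq_mul2l lemn orbT.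
Qed.

Lemma gsteps_in_ball (Sigma : finType) (A : gautomaton 'M[int]_3 Sigma) :
  is_G_automaton heisenberg_mem A ->
  exists K, forall q w n q' y,
    @gsteps _ Sigma (@mulmx int 3 3 3) A q 1%:M w n q' y -> in_ball K n y.
Proof.
move=> HA.
pose entry_max (M : 'M[int]_3) := \max_(p : 'I_3 * 'I_3) `|M p.1 p.2|%N.
pose K := \max_(e <- transitions A) entry_max e.2.2.
exists K.
have step q l t n x : t \in @gdelta _ Sigma A q l -> in_ball K n x -> in_ball K n.+1 (x *m t.2).
  move=> tr [a [b [c [-> Ha Hb Hc]]]].
  have [a' [b' [c' Dt]]] := heisenberg_memP (HA _ _ _ tr).
  have entryK i' j' : (`|t.2 i' j'| <= K)%N.
    apply: leq_trans (_ : entry_max t.2 <= _)%N.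
      exact: (@leq_bigmax _ (fun p : 'I_3 * 'I_3 => `|t.2 p.1 p.2|%N) (i', j')).
    exact: (@leq_bigmax_seq _ _ _ (fun e : transition A => entry_max e.2.2) _ (mem_transitions tr)).
  rewrite Dt in entryK *; have [Ha' Hb' Hc'] := heis_entries_le entryK.
  rewrite heisM; exists (a + a'), (b + a * c' + b'), (c + c'); split=> //; [nia| |nia].
  have Hac : (`|(a * c')%R| <= K * n * K)%N by rewrite abszM leq_mul.
  apply: leq_trans (_ : `|b| + `|(a * c')%R| + `|b'| <= _)%N; first lia.
  by apply: leq_trans (leq_add (leq_add Hb Hac) Hb') _; nia.
(* The induction needs an arbitrary starting register, with [j] counting the steps already spent. *)
suff H q x w n q' y : @gsteps _ Sigma (@mulmx int 3 3 3) A q x w n q' y ->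
    forall j, in_ball K j x -> in_ball K (j + n) y.
  move=> q w n q' y /H/(_ 0%N); apply; exists 0, 0, 0; split=> //; exact: heis1.
elim=> {q x w n q' y} [q x|q x w n q1 m q2 y tr _ IH|q x a w n q1 m q2 y tr _ IH] j bx.
- by rewrite addn0.
- by rewrite addnS -addSn; apply: IH; apply: step tr bx.
- by rewrite addnS -addSn; apply: IH; apply: step tr bx.
Qed.

(** The shift of the interval from [-B] to [B] onto the one from [0] to [2 * B]; only values in that
    interval are coded faithfully. *)
Definition int_code (B : nat) (a : int) : 'I_(2 * B).+1 := inord `|(a + B%:Z)%R|%N.

Lemma int_code_inj B a b :
  (`|a| <= B)%N -> (`|b| <= B)%N -> int_code B a = int_code B b -> a = b.
Proof.
move=> Ha Hb /(congr1 val); rewrite /= !inordK; lia.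
Qed.

(* A configuration reached within a linear number of steps is one of
   polynomially many (of degree 4), and it must separate the prefixes [x i]. *)
Lemma L_H_lin_fooling (Sigma : finType) (L : seq Sigma -> Prop) :
  L_H_lin L -> exists C, forall (I : finType) (x y : I -> seq Sigma) s,
    (forall i, (size (x i ++ y i) <= s)%N) ->
    (forall i j, L (x i ++ y j) <-> i = j) ->
    (#|I| <= C * s.+1 ^ 4)%N.
Proof.
move=> [A [HA [LA [t [[c [N tc]] At]]]]].
have [K HK] := gsteps_in_ball HA.
(* The maximum covers the finitely many lengths below [N], where [c] gives no bound. *)
pose D := (c + \max_(n < N) t n)%N.
have tD n : (t n <= D * n.+1)%N.
  have [leNn|ltnN] := leqP N n; first by apply: leq_trans (tc _ leNn) _; rewrite /D; nia.
  have := @leq_bigmax _ (fun n : 'I_N => t n) (Ordinal ltnN); rewrite /D /=; nia.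
pose B1 := (K * D)%N; pose B2 := ((K + K ^ 2) * D ^ 2)%N.
exists (#|gQ A| * ((2 * B1).+1 ^ 2 * (2 * B2).+1))%N => I x y s szs Lxy.
pose n1 := (K * (D * s.+1))%N; pose n2 := ((K + K ^ 2) * (D * s.+1) ^ 2)%N.
(* [z] is a configuration between [x i] and [y i] in an accepting computation. *)
pose good i (z : gQ A * (int * int * int)) :=
  let: (q, (a, b, c)) := z in
  [/\ exists n, @gsteps _ Sigma (@mulmx int 3 3 3) A (gq0 A) 1%:M (x i) n q (heis a b c),
      exists n q', q' \in gacc A /\
        @gsteps _ Sigma (@mulmx int 3 3 3) A q (heis a b c) (y i) n q' 1%:M,
      (`|a| <= n1)%N, (`|b| <= n2)%N & (`|c| <= n1)%N].
have /fin_all_exists[z zP] : forall i, exists z, good i z.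
  move=> i; have [n [q' [len [accq']]]] := At _ ((Lxy i i).2 erefl).
  case/gsteps_catI=> m1 [m2 [q [z [Dn s1 s2]]]].
  have [||a [b [d [Dz Ha Hb Hd]]]] := @in_ball_le K m1 (D * s.+1)%N z.
  - apply: leq_trans (leq_addr m2 m1) _; rewrite -Dn; apply: leq_trans len _.
    by apply: leq_trans (tD _) _; rewrite leq_mul2l ltnS szs orbT.
  - exact: HK s1.
  exists (q, (a, b, d)); rewrite Dz in s1 s2.
  by split=> //; [exists m1 | exists m2, q'].
pose code i := let: (q, (a, b, c)) := z i in
  (q, (int_code n1 a, int_code n1 c, int_code n2 b)).
have code_inj : injective code.
  move=> i j; rewrite /code; have := zP i; have := zP j; rewrite /good.
  case: (z i) (z j) => q [[a b] d] [q' [[a' b'] d']].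
  move=> [[m1' s1'] [m2' [q2' [acc' s2']]] Ha' Hb' Hc'] [[m1 s1] _ Ha Hb Hc] [Dq Da Dc Db].
  move: s1; rewrite Dq (int_code_inj Ha Ha' Da) (int_code_inj Hb Hb' Db) (int_code_inj Hc Hc'
    Dc) => s1.
  (* Equal configurations allow the run on [x i] to continue with the one on [y j]. *)
  apply/Lxy/LA; exists (m1 + m2')%N, q2'; split=> //.
  exact: gsteps_cat s1 s2'.
have := leq_card _ code_inj; rewrite !card_prod !card_ord => /leq_trans; apply.
rewrite -[leqRHS]mulnA leq_mul2l; apply/orP; right.
have E1 : ((2 * n1).+1 <= (2 * B1).+1 * s.+1)%N by rewrite /n1 /B1; nia.
have E2 : ((2 * n2).+1 <= (2 * B2).+1 * s.+1 ^ 2)%N.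
  by rewrite /n2 /B2 expnMn; move: (s.+1 ^ 2)%N (expn_gt0 s.+1 2) => ?; nia.
apply: leq_trans (leq_mul (leq_mul E1 E1) E2) _.
rewrite leq_eqVlt; apply/orP; left; apply/eqP; ring.
Qed.

(** * Separating languages *)

Definition triangular (w : seq unit) : Prop := exists p, size w = 'C(p.+1, 2).

Lemma leq_triangular p : (p <= 'C(p.+1, 2))%N.
Proof. by rewrite binS bin1 leq_addl. Qed.

Lemma triangular_homo p q : (p <= q)%N -> ('C(p.+1, 2) <= 'C(q.+1, 2))%N.
Proof. by move=> lepq; apply: leq_bin2l. Qed.

Lemma triangular_unbounded n : exists2 w, triangular w & (n <= size w)%N.
Proof.
exists (nseq 'C(n.+1, 2) tt); first by exists n; rewrite size_nseq.
by rewrite size_nseq leq_triangular.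
Qed.

(** From the [d]-th triangular number on, consecutive ones differ by more than [d], whereas the
    progression has terms at distance [d] there. *)
Lemma triangular_no_progression : ~ lengths_contain_progression triangular.
Proof.
move=> [n0 [d [d_gt0 H]]].
have [w [p Dp] sz] := H 'C(d.+1, 2); have [w' [p' Dp'] sz'] := H ('C(d.+1, 2).+1).
have led : ('C(d.+1, 2) <= 'C(p.+1, 2))%N by rewrite -Dp sz; nia.
have ltp : ('C(p.+1, 2) < 'C(p'.+1, 2))%N by rewrite -Dp -Dp' sz sz'; nia.
have ltpp' : (p < p')%N.
  by rewrite ltnNge; apply/negP => /triangular_homo; rewrite leqNgt ltp.
have ledp : (d <= p)%N.
  rewrite leqNgt; apply/negP => ltpd; have := triangular_homo ltpd.
  rewrite [in X in (X <= _)%N]binS bin1; lia.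
have := triangular_homo ltpp'; rewrite [in X in (X <= _)%N]binS bin1; lia.
Qed.

Local Notation st k := (@Ordinal 3 k isT).

(* In state 0 the letters are read, each multiplying the register by [g] =
   [heis 1 0 1] or by the central [heis 0 (-1) 0]; with [p] letters of the
   first kind the other two entries equal to [p] must be cancelled in states 1
   and 2, which leaves ['C(p, 2)] in the corner. *)
Definition triangular_delta (q : 'I_3) (l : option unit) : seq ('I_3 * 'M[int]_3) :=
  match val q, l with
  | 0%N, Some _ => [:: (st 0, heis 1 0 1); (st 0, heis 0 (-1) 0)]
  | 0%N, None => [:: (st 1, heis 0 0 0)]
  | 1%N, None => [:: (st 1, heis (-1) 0 0); (st 2, heis 0 0 0)]
  | 2%N, None => [:: (st 2, heis 0 0 (-1))]
  | _, _ => [::]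
  end.

Definition triangular_automaton : gautomaton 'M[int]_3 unit :=
  @GAut 'M[int]_3 unit 'I_3 triangular_delta (st 0) [set st 2].

Local Notation tsteps := (@gsteps 'M[int]_3 unit (@mulmx int 3 3 3) triangular_automaton).

(** [p] and [r] count the letters read as [heis 1 0 1] and as [heis 0 (-1) 0]; [p'] and [q'] count
    the cancelling loops in states 1 and 2. *)
Definition triangular_invariant (q : 'I_3) (x : 'M[int]_3) (n : nat) : Prop :=
  exists p p' q' r : nat,
    [/\ x = heis (p%:Z - p'%:Z) ('C(p, 2)%:Z - r%:Z - (p%:Z - p'%:Z) * q'%:Z) (p%:Z - q'%:Z),
        n = (p + r)%N, (q < 1)%N -> p' = 0%N & (q < 2)%N -> q' = 0%N].

Lemma triangular_invariant_step q l t x n :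
  t \in triangular_delta q l -> triangular_invariant q x n ->
  triangular_invariant t.1 (x *m t.2) (n + (l != None)).
Proof.
case: q => [[|[|[|//]]] lt] + [p [p' [q' [r [-> -> Hp Hq]]]]]; case: l => [[]|];
  rewrite /triangular_delta /= ?inE // => H.
- rewrite (Hp isT) (Hq isT); case/orP: H => /eqP-> /=; rewrite heisM.
    exists p.+1, 0%N, 0%N, r; split=> //; last lia.
    by rewrite binS bin1; congr heis; lia.
  exists p, 0%N, 0%N, r.+1; split=> //; last lia.
  by congr heis; lia.
- rewrite (Hp isT) (Hq isT); rewrite (eqP H) heisM.
  exists p, 0%N, 0%N, r; split=> //; last lia.
  by congr heis; lia.
- rewrite (Hq isT); case/orP: H => /eqP-> /=; rewrite heisM.
    exists p, p'.+1, 0%N, r; split=> //; last lia.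
    by congr heis; lia.
  exists p, p', 0%N, r; split=> //; last lia.
  by congr heis; lia.
- rewrite (eqP H) heisM; exists p, p', q'.+1, r; split=> //; last lia.
  by congr heis; lia.
Qed.

Lemma triangular_invariant_steps q x w n q' y : tsteps q x w n q' y ->
  forall j, triangular_invariant q x j -> triangular_invariant q' y (j + size w).
Proof.
elim=> {q x w n q' y} [q x|q x w n q1 m q2 y tr _ IH|q x a w n q1 m q2 y tr _ IH] j inv.
- by rewrite addn0.
- by rewrite -[j]addn0; apply/IH/(triangular_invariant_step tr inv).
- by rewrite /= -addSnnS -addn1; apply/IH/(triangular_invariant_step tr inv).
Qed.

Lemma gsteps_loop (T : eqType) (Sigma : finType) (mul : T -> T -> T)
    (A : gautomaton T Sigma) q l m (x : nat -> T) k :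
  (q, m) \in @gdelta T Sigma A q l -> (forall i, mul (x i) m = x i.+1) ->
  @gsteps T Sigma mul A q (x 0%N) (if l is Some a then nseq k a else [::]) k q (x k).
Proof.
move=> tr; elim: k x => [|k IH] x xS; first by case: l {tr} => [a|]; constructor.
have := IH (fun i => x i.+1) (fun i => xS i.+1).
by case: l tr {IH} => [a|] tr s; [apply: gsteps_read tr _ | apply: gsteps_eps tr _]; rewrite xS.
Qed.

Lemma triangular_complete p : exists n, (n <= 3 * 'C(p.+1, 2) + 2)%N /\
  tsteps (st 0) 1%:M (nseq 'C(p.+1, 2) tt) n (st 2) 1%:M.
Proof.
pose r := 'C(p, 2).
have s1 : tsteps (st 0) (heis 0 0 0) (nseq p tt) p (st 0) (heis p%:Z r%:Z p%:Z).
  apply: (@gsteps_loop _ _ _ triangular_automaton (st 0) (Some tt) (heis 1 0 1)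
    (fun i => heis i%:Z 'C(i, 2)%:Z i%:Z)) => [|i]; first exact: mem_head.
  by rewrite heisM binS bin1; congr heis; lia.
have s2 : tsteps (st 0) (heis p%:Z r%:Z p%:Z) (nseq r tt) r (st 0) (heis p%:Z 0 p%:Z).
  have := @gsteps_loop _ _ (@mulmx int 3 3 3) triangular_automaton (st 0) (Some tt) (heis 0 (-1) 0)
    (fun i => heis p%:Z (r%:Z - i%:Z) p%:Z) r.
  rewrite subr0 subrr; apply=> [|i]; first by rewrite !inE eqxx orbT.
  by rewrite heisM; congr heis; lia.
(* The first entry is cancelled before the last one: in both loops the cross term is then 0 and the
   corner stays 0. *)
have s3 : tsteps (st 1) (heis p%:Z 0 p%:Z) [::] p (st 1) (heis 0 0 p%:Z).
  have := @gsteps_loop _ _ (@mulmx int 3 3 3) triangular_automaton (st 1) None (heis (-1) 0 0)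
    (fun i => heis (p%:Z - i%:Z) 0 p%:Z) p.
  rewrite subr0 subrr; apply=> [|i]; first exact: mem_head.
  by rewrite heisM; congr heis; lia.
have s4 : tsteps (st 2) (heis 0 0 p%:Z) [::] p (st 2) (heis 0 0 0).
  have := @gsteps_loop _ _ (@mulmx int 3 3 3) triangular_automaton (st 2) None (heis 0 0 (-1))
    (fun i => heis 0 0 (p%:Z - i%:Z)) p.
  rewrite subr0 subrr; apply=> [|i]; first exact: mem_head.
  by rewrite heisM; congr heis; lia.
(* The four loops, plus two steps that change the state. *)
exists (p + (r + (p + p.+1).+1))%N; split.
  by have := leq_triangular p; rewrite binS bin1 -/r; lia.
rewrite heis1 binS bin1 addnC nseqD; apply: gsteps_cat s1 _.
rewrite -/r -[nseq r tt]cats0; apply: gsteps_cat s2 _.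
apply: (@gsteps_eps _ _ _ triangular_automaton _ _ _ _ (st 1) (heis 0 0 0)); first exact: mem_head.
rewrite heisM !addr0 mulr0 addr0; apply: (gsteps_cat s3).
apply: (@gsteps_eps _ _ _ triangular_automaton _ _ _ _ (st 2) (heis 0 0 0)).
  by rewrite !inE eqxx orbT.
by rewrite heisM !addr0.
Qed.

Lemma L_H_lin_triangular : L_H_lin triangular.
Proof.
have complete w : triangular w ->
    gaccepts_within (@mulmx int 3 3 3) 1%:M triangular_automaton w (3 * size w + 2).
  move=> [p Dw]; have [n [len s]] := triangular_complete p.
  have Dw' : w = nseq 'C(p.+1, 2) tt.
    by rewrite -Dw; elim: (w) => [|[] w' {1}->].
  by exists n, (st 2); rewrite Dw inE eqxx Dw'.
exists triangular_automaton; split; last split.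
- move=> q l t; rewrite /gdelta /= /triangular_delta.
  by case: q => [[|[|[|//]]] lt]; case: l => [a|] //=; rewrite !inE;
    do ?[case/orP]; move/eqP->; apply: heisenberg_mem_heis.
- move=> w; split=> [/complete[n [q [_ H]]]|[n [q [acc s]]]]; first by exists n, q.
  have inv0 : triangular_invariant (st 0) 1%:M 0.
    by exists 0%N, 0%N, 0%N, 0%N; split=> //; rewrite heis1; congr heis; lia.
  have [p [p' [q' [r [E sz _ _]]]]] := triangular_invariant_steps s inv0.
  exists p; rewrite binS bin1; move: E; rewrite heis1 => /heis_inj[E1 E2 E3].
  (* As [p - p'] vanishes, the corner entry forces [r] to be ['C(p, 2)], and the length is
     [p + r]. *)
  move: E2; rewrite -E1 mul0r subr0 => /esym/eqP.
  by rewrite subr_eq0 => /eqP[->]; rewrite addnC -sz.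
exists (fun n => 3 * n + 2)%N; split; last exact: complete.
by exists 5%N, 1%N => n; lia.
Qed.

Lemma large_fooling_set_not_L_H_lin (Sigma : finType) (L : seq Sigma -> Prop)
    (I : nat -> finType) (x y : forall m, I m -> seq Sigma) :
  (forall m, (m.+1 ^ 5 <= #|I m|)%N) ->
  (forall m i, (size (x m i ++ y m i) <= 10 * m)%N) ->
  (forall m i j, L (x m i ++ y m j) <-> i = j) -> ~ L_H_lin L.
Proof.
move=> big sz Lxy /L_H_lin_fooling[C HC].
(* With this [m], [C * (10 * m).+1 ^ 4] is at most [m * m.+1 ^ 4], which is less than [m.+1 ^ 5]. *)
pose m := (C * 10 ^ 4)%N.
have := HC _ _ _ (10 * m)%N (sz m) (Lxy m); apply/negP; rewrite -ltnNge.
apply: leq_trans (big m); rewrite expnS.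
apply: leq_trans (_ : (C * 10 ^ 4).+1 * m.+1 ^ 4 <= _)%N; last by rewrite leq_mul2r leqnn orbT.
have pos : (0 < m.+1 ^ 4)%N by rewrite expn_gt0.
have : (C * (10 * m).+1 ^ 4 <= C * (10 ^ 4 * m.+1 ^ 4))%N.
  by rewrite leq_mul2l -expnMn leq_exp2r // orbC; apply/orP; left; lia.
rewrite mulnA mulSn; lia.
Qed.

(** * Five balanced pairs of letters *)

Definition balanced (w : seq ('I_5 * bool)) : Prop :=
  forall i, count_mem (i, true) w = count_mem (i, false) w.

Definition balanced_vector (k : nat) (a : 'I_5 * bool) : 'rV[int]_k :=
  \row_j (if j == a.1 :> nat then (-1) ^+ (~~ a.2) else 0).

Definition balanced_automaton (k : nat) : gautomaton 'rV[int]_k ('I_5 * bool)%type :=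
  @GAut 'rV[int]_k ('I_5 * bool)%type unit
    (fun _ l => if l is Some a then [:: (tt, balanced_vector k a)] else [::]) tt setT.

Lemma balanced_stepsP k q x w n q' y :
  @gsteps 'rV[int]_k _ +%R (balanced_automaton k) q x w n q' y <->
  [/\ n = size w, y = x + \sum_(a <- w) balanced_vector k a & q = q'].
Proof.
split.
  elim=> {q x w n q' y} [[] x|//|[] x a w n [] m [] y tr _ [-> -> _]].
    by rewrite big_nil addr0.
  by move: tr; rewrite big_cons inE => /eqP[->]; rewrite addrA.
case=> -> -> ->; elim: w x => [|a w IH] x /=; first by rewrite big_nil addr0; constructor.
case: q' IH => IH; apply: (@gsteps_read _ _ _ (balanced_automaton k) _ _ _ _ _ tt
  (balanced_vector k a)).
  by rewrite inE.
by rewrite big_cons addrA; apply: IH.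
Qed.

Lemma sum_balanced_vector k (w : seq ('I_5 * bool)) (i : 'I_5) (j : 'I_k) : j = i :> nat ->
  (\sum_(a <- w) balanced_vector k a) 0 j =
    (count_mem (i, true) w)%:Z - (count_mem (i, false) w)%:Z.
Proof.
move=> Dj; elim: w => [|[i' b] w IH]; first by rewrite big_nil mxE.
rewrite big_cons mxE IH mxE /= Dj !xpair_eqE eq_sym.
have -> : (val i' == val i) = (i' == i) by [].
by case: (i' == i); case: b => /=; lia.
Qed.

Lemma sum_balanced_vector0 k (w : seq ('I_5 * bool)) (j : 'I_k) : (5 <= j)%N ->
  (\sum_(a <- w) balanced_vector k a) 0 j = 0.
Proof.
move=> lej; rewrite summxE big1 // => a _; rewrite mxE; case: eqP => // Dj.
by move: (ltn_ord a.1); rewrite -Dj ltnNge lej.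
Qed.

Lemma L_Zk_lin_balanced k : (5 <= k)%N -> L_Zk_lin k balanced.
Proof.
move=> lek; exists (balanced_automaton k); split=> //.
have sum0 w : balanced w <-> \sum_(a <- w) balanced_vector k a = 0.
  split=> [bal|E i].
    apply/rowP=> j; rewrite [RHS]mxE; have [lej|ltj] := leqP 5 j.
      exact: sum_balanced_vector0.
    by rewrite (@sum_balanced_vector _ _ (Ordinal ltj)) // bal subrr.
  have := sum_balanced_vector w (erefl (val (widen_ord lek i))).
  by rewrite E mxE => /esym/eqP; rewrite subr_eq0 => /eqP[].
have complete w : balanced w ->
    gaccepts_within +%R 0 (balanced_automaton k) w (size w).
  move=> /sum0 E; exists (size w), tt; rewrite inE; split=> //; split=> //.
  by apply/balanced_stepsP; rewrite E addr0.
split; last first.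
  exists id; split=> //; exists 1%N, 0%N => n _; lia.
move=> w; split=> [/complete[n [q [_ H]]]|[n [q [_ /balanced_stepsP[_ E _]]]]];
  first by exists n, q.
by apply/sum0; rewrite {2}E add0r.
Qed.

Definition exponent_word m (b : bool) (f : {ffun 'I_5 -> 'I_m.+1}) : seq ('I_5 * bool) :=
  flatten [seq nseq (f i) (i, b) | i <- index_enum 'I_5].

Lemma count_exponent_word m b b' (f : {ffun 'I_5 -> 'I_m.+1}) i :
  count_mem (i, b') (exponent_word b f) = if b == b' then nat_of_ord (f i) else 0%N.
Proof.
rewrite count_flatten -!map_comp sumnE big_map /= (bigD1 i) //= big1 => [|j neqji].
  by rewrite count_nseq /= xpair_eqE eqxx addn0; case: eqP; rewrite ?mul1n.
by rewrite count_nseq /= xpair_eqE (negPf neqji).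
Qed.

Lemma size_exponent_word m b (f : {ffun 'I_5 -> 'I_m.+1}) : (size (exponent_word b f) <= 5 * m)%N.
Proof.
rewrite size_flatten /shape -map_comp sumnE big_map /=.
apply: leq_trans (_ : \sum_(i < 5) m <= _)%N; last by rewrite sum_nat_const card_ord.
by apply: leq_sum => i _; rewrite size_nseq -ltnS.
Qed.

(** The letter counts of an exponent word determine [f], so a prefix for [f] and a suffix for [g]
    balance exactly when [f = g]. *)
Lemma balanced_not_L_H_lin : ~ L_H_lin balanced.
Proof.
apply: (@large_fooling_set_not_L_H_lin _ _ (fun m => {ffun 'I_5 -> 'I_m.+1})
  (fun m => exponent_word true) (fun m => exponent_word false)) => [m|m f|m f g].
- by rewrite card_ffun !card_ord.
- rewrite size_cat; apply: leq_trans (leq_add (size_exponent_word _ f) (size_exponent_word _ f)) _.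
  by rewrite -mulnDl.
split=> [bal|->]; last by move=> i; rewrite !count_cat !count_exponent_word /= addn0.
apply/ffunP=> i; apply: val_inj; have := bal i.
by rewrite !count_cat !count_exponent_word /= addn0.
Qed.

(** * Even palindromes *)

Definition even_palindrome (w : seq bool) : Prop := exists u, w = u ++ rev u.

Definition palindrome_grammar : cfg bool :=
  @CFG bool unit tt
    ((tt, [::]) :: [seq (tt, [:: inr b; inl tt; inr b]) | b <- [:: true; false]]).

(** The intended meaning of a sentential form: the nonterminal stands for any even palindrome, a
    letter for itself. *)
Fixpoint palindrome_form (s : seq (unit + bool)) (w : seq bool) : Prop :=
  match s with
  | [::] => w = [::]
  | inr b :: s' => exists2 w', w = b :: w' & palindrome_form s' w'
  | inl _ :: s' => exists w1 w2, [/\ w = w1 ++ w2, even_palindrome w1 & palindrome_form s' w2]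
  end.

Lemma palindrome_formP s w : @yields bool palindrome_grammar s w -> palindrome_form s w.
Proof.
elim=> {s w} [|b s w _ IH|[] rhs s w1 w2 Xr _ IH1 _ IH2] //=; first by exists w.
exists w1, w2; split=> //.
have rhsE : rhs = [::] \/ exists b, rhs = [:: inr b; inl tt; inr b].
  by move: Xr; rewrite !inE => /or3P[] /eqP[->]; [left | right; exists true | right; exists false].
case: rhsE IH1 => [->|[b ->]] /=; first by move->; exists [::].
move=> [_ -> [_ [_ [-> [u ->] [_ -> ->]]]]]; exists (b :: u).
by rewrite rev_cons -cats1 catA.
Qed.

Lemma context_free_even_palindrome : context_free even_palindrome.
Proof.
exists palindrome_grammar => w; split=> [[u ->]|]; last first.
  by case/derives_yields/palindrome_formP=> [w1 [_ [-> pal ->]]]; rewrite cats0.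
elim: u => [|b u IH].
  by apply: (@derives_rule _ palindrome_grammar tt [::]); [exact: mem_head | exact: cfg_refl].
apply: (@derives_rule _ palindrome_grammar tt [:: inr b; inl tt; inr b]); first by case: b;
  rewrite !inE eqxx ?orbT.
rewrite rev_cons -cats1 catA /= map_cat.
exact: (derives_context [:: inr b] [:: inr b] IH).
Qed.

Lemma even_palindrome_not_L_H_lin : ~ L_H_lin even_palindrome.
Proof.
have pal_sym w : even_palindrome w -> rev w = w.
  by move=> [u ->]; rewrite rev_cat revK.
apply: (@large_fooling_set_not_L_H_lin _ _ (fun m => (5 * m).-tuple bool)
  (fun m u => u) (fun m u => rev u)) => [m|m u|m u v].
(* Length [5 * m] gives [(2 ^ m) ^ 5] words, and [m < 2 ^ m]. *)
- by rewrite card_tuple card_bool mulnC expnM leq_exp2r // ltn_expl.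
- by rewrite size_cat size_rev size_tuple; lia.
split=> [/pal_sym|->]; last by exists v.
rewrite rev_cat revK => /eqP; rewrite eqseq_cat ?size_tuple // => /andP[/eqP E _].
exact/val_inj/esym.
Qed.

Theorem theorem4p10 :
  (forall k : nat, (5 <= k)%N -> incomparable L_H_lin (L_Zk_lin k)) /\
  incomparable L_H_lin context_free.
Proof.
split=> [k lek|]; split.
- exists unit, triangular; split; first exact: L_H_lin_triangular.
  by move/L_Zk_lin_lengths/(_ triangular_unbounded)/triangular_no_progression.
- exists ('I_5 * bool)%type, balanced; split; first exact: L_Zk_lin_balanced.
  exact: balanced_not_L_H_lin.
- exists unit, triangular; split; first exact: L_H_lin_triangular.
  by move/context_free_lengths/(_ triangular_unbounded)/triangular_no_progression.
- exists bool, even_palindrome; split; first exact: context_free_even_palindrome.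
  exact: even_palindrome_not_L_H_lin.
Qed.
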